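(* Let $(U,D_U,m_U)$ and $(A,D_A,m_A)$ be sets with partial multiplications and with mutual actions $(\alpha,u)\mapsto\alpha\cdot u\in U$ and $(\alpha,u)\mapsto\alpha^u\in A$ defined on $H\subseteq A\times U$. Let $E=U\times A$ and put on $U\times A$ the partial multiplication $$(u,\alpha)(v,\beta)=(u(\alpha\cdot v),\ \alpha^v\beta),$$ where the left side is defined if and only if all of $(\alpha,v)\in H$, $(u,\alpha\cdot v)\in D_U$ and $(\alpha^v,\beta)\in D_A$ hold. With the properties (P2), (P5), (P7) listed in the context, the following hold. (xi) If (P7)(a,e,g) hold and $(u,\alpha)$ is a right identity for $U\times A$, then $u$ is a right identity for $U$ and $\alpha$ is a right identity for $A$. (xii) If (P7)(a,e) hold, then $(u,\alpha)$ is a right identity for $U\times A$ whenever $u$ is a right identity for $U$ and $\alpha$ is a right identity for $A$. (xiii) If $A$ and $U$ have right identities and (P7)(a,e,g) and (P5)(a) all hold, then $U\times A$ has right identities. (xiv) If $A$ and $U$ have left inverses with respect to right identities and (P2)(a,c), (P7)(a,c,e,g) and (P5)(b) hold, then $U\times A$ has left inverses with respect to right identities. (xv) If $A$ and $U$ are monoids, $H=A\times U$, and (P2)(a–d) and (P7)(a,d,e,f) all hold, then $U\times A$ is a monoid. Further, $j(u)=1_A$ and $i(\alpha)=1_U$ make valid embedding functions. (xvi) If $A$ and $U$ are groups, $H=A\times U$, and (P2)(a–d) and (P7)(a–h) hold, then $U\times A$ is a group.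
   Context: A set with partial multiplication is a triple $(X,D,m)$ with $X$ a set, $D\subseteq X\times X$ and $m:D\to X$ a function; write $xDy$ (''$xy$ is defined'') for $(x,y)\in D$ and $xy$ for $m(x,y)$. Mutual actions on $H$ are simply two functions $H\to U$, $(\alpha,u)\mapsto\alpha\cdot u$, and $H\to A$, $(\alpha,u)\mapsto\alpha^u$. A right identity for an element $x$ is an $e$ with $xDe$ and $xe=x$. A right identity for $X$ is an $e\in X$ that is a right identity for every $x$ with $xDe$, and for which at least one $x$ with $xDe$ exists. Left identities are defined symmetrically. A full identity of $X$ is both a right and a left identity for $X$. $X$ has right identities if every element of $X$ has a right identity that is also a right identity for $X$. $X$ has left inverses with respect to right identities if there is an $x$ with $xa=b$ whenever $b$ is a right identity for $X$ and $ab$ is defined. A monoid is a set with an everywhere defined associative multiplication with a two-sided identity. Properties: (P2) For each of the following, the property means: whenever one side (with all its intermediate products) is defined, so is the other (with all its intermediate products), and the two sides are equal. (a) $(\alpha\beta)\cdot u=\alpha\cdot(\beta\cdot u)$; (b) $(\alpha\beta)^u=\alpha^{\beta\cdot u}\beta^u$; (c) $\alpha\cdot(uv)=(\alpha\cdot u)(\alpha^u\cdot v)$; (d) $\alpha^{uv}=(\alpha^u)^v$. (P5) (a) for each $\alpha\in A$ and $v\in U$ there is a $u\in U$ with $\alpha\cdot u=v$; (b) for each $u\in U$ and $\beta\in A$ there is an $\alpha\in A$ with $\alpha^u=\beta$. (P7) (a) $\alpha^u=\alpha$ for every $\alpha\in A$ and right identity $u$ for $U$. (b) $\alpha^u=\alpha$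 for every $\alpha\in A$ and left identity $u$ for $U$. (c) $\alpha\cdot u=u$ for every $u\in U$ and right identity $\alpha$ for $A$. (d) $\alpha\cdot u=u$ for every $u\in U$ and left identity $\alpha$ for $A$. (e) If $u$ is a right identity for $U$, then $(\alpha,u)\in H$ and $\alpha\cdot u$ is a right identity for $U$ for all $\alpha\in A$. (f) If $\alpha$ is a left identity for $A$, then $(\alpha,u)\in H$ and $\alpha^u$ is a left identity for $A$ for all $u\in U$. (g) $u$ is a right identity for $U$ whenever $\alpha\cdot u$ is a right identity for $U$. (h) $\alpha$ is a left identity for $A$ whenever $\alpha^u$ is a left identity for $A$. Embedding functions (here with $E=U\times A$): a pair $i:A\to U$, $j:U\to A$ such that (1) for all $u,v\in U$: $j(u)$ is a full identity of $A$; $uD_Uv$ implies $j(u)=j(v)=j(uv)$; $(u,j(u))\in E$; $(j(u),u)\in H$; $j(u)\cdot u=u$; $(j(u))^u=j(u)$; $j(u)D_Aj(u)$; (2) for all $\alpha,\beta\in A$: $i(\alpha)$ is a full identity of $U$; $\alpha D_A\beta$ implies $i(\alpha)=i(\beta)=i(\alpha\beta)$; $(i(\alpha),\alpha)\in E$; $(\alpha,i(\alpha))\in H$; $\alpha\cdot i(\alpha)=i(\alpha)$; $\alpha^{i(\alpha)}=\alpha$; $i(\alpha)D_Ui(\alpha)$; (3) $(\alpha,u)\in H$ implies $i(\alpha)D_U(\alpha\cdot u)$ and $\alpha^uD_Aj(u)$; (4) $(u,\alpha)\in E$ implies $(j(u),i(\alpha))\in H$, $j(u)\cdot i(\alpha)=i(\alpha)$,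 $(j(u))^{i(\alpha)}=j(u)$, $uD_Ui(\alpha)$ and $j(u)D_A\alpha$. *)

(* Defs.v *)
From mathcomp Require Import ssreflect ssrfun ssrbool.

Set Implicit Arguments.
Unset Strict Implicit.
Unset Printing Implicit Defensive.

(* The partial map m : D -> X is encoded by its domain [pdom] together with a
   total function [pmul] whose values outside [pdom] are arbitrary; every notion
   below that involves a product in a non-total structure also asserts, or
   assumes, that the product is defined. *)
Record partial_mul (X : Type) := PartialMul {
  pdom : X -> X -> Prop;
  pmul : X -> X -> X
}.

(* Same encoding: [adom] is H, [lact a u] is a . u, and [ract a u] is a ^ u. *)
Record mutual_actions (A U : Type) := MutualActions {
  adom : A -> U -> Prop;
  lact : A -> U -> U;
  ract : A -> U -> A
}.

Section PartialMul.
Variables (X : Type) (M : partial_mul X).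

Definition right_identity_for_elt (x e : X) : Prop :=
  pdom M x e /\ pmul M x e = x.

Definition left_identity_for_elt (x e : X) : Prop :=
  pdom M e x /\ pmul M e x = x.

Definition right_identity (e : X) : Prop :=
  (forall x, pdom M x e -> right_identity_for_elt x e) /\
  (exists x, pdom M x e).

Definition left_identity (e : X) : Prop :=
  (forall x, pdom M e x -> left_identity_for_elt x e) /\
  (exists x, pdom M e x).

Definition full_identity (e : X) : Prop :=
  right_identity e /\ left_identity e.

Definition has_right_identities : Prop :=
  forall x, exists e, right_identity_for_elt x e /\ right_identity e.

Definition has_left_inverses_wrt_right_identities : Prop :=
  forall a b, right_identity b -> pdom M a b ->
    exists x, pdom M x a /\ pmul M x a = b.

Definition everywhere_defined : Prop := forall x y, pdom M x y.

Definition monoid_with_unit (e : X) : Prop :=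
  [/\ everywhere_defined, associative (pmul M),
      left_id e (pmul M) & right_id e (pmul M)].

Definition is_monoid : Prop := exists e, monoid_with_unit e.

Definition is_group : Prop :=
  exists2 e, monoid_with_unit e &
    forall x, exists y, pmul M x y = e /\ pmul M y x = e.

End PartialMul.

Section ZappaSzep.
Variables (U A : Type) (MU : partial_mul U) (MA : partial_mul A).
Variable act : mutual_actions A U.

Definition zs_product : partial_mul (U * A) :=
  {| pdom := fun p q =>
       [/\ adom act p.2 q.1,
           pdom MU p.1 (lact act p.2 q.1) &
           pdom MA (ract act p.2 q.1) q.2];
     pmul := fun p q =>
       (pmul MU p.1 (lact act p.2 q.1), pmul MA (ract act p.2 q.1) q.2) |}.

Definition P2a : Prop := forall (a b : A) (u : U),
  ((pdom MA a b /\ adom act (pmul MA a b) u) <->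
   (adom act b u /\ adom act a (lact act b u))) /\
  (pdom MA a b -> adom act (pmul MA a b) u ->
   lact act (pmul MA a b) u = lact act a (lact act b u)).

Definition P2b : Prop := forall (a b : A) (u : U),
  ((pdom MA a b /\ adom act (pmul MA a b) u) <->
   [/\ adom act b u, adom act a (lact act b u) &
       pdom MA (ract act a (lact act b u)) (ract act b u)]) /\
  (pdom MA a b -> adom act (pmul MA a b) u ->
   ract act (pmul MA a b) u =
   pmul MA (ract act a (lact act b u)) (ract act b u)).

Definition P2c : Prop := forall (a : A) (u v : U),
  ((pdom MU u v /\ adom act a (pmul MU u v)) <->
   [/\ adom act a u, adom act (ract act a u) v &
       pdom MU (lact act a u) (lact act (ract act a u) v)]) /\
  (pdom MU u v -> adom act a (pmul MU u v) ->
   lact act a (pmul MU u v) =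
   pmul MU (lact act a u) (lact act (ract act a u) v)).

Definition P2d : Prop := forall (a : A) (u v : U),
  ((pdom MU u v /\ adom act a (pmul MU u v)) <->
   (adom act a u /\ adom act (ract act a u) v)) /\
  (pdom MU u v -> adom act a (pmul MU u v) ->
   ract act a (pmul MU u v) = ract act (ract act a u) v).

Definition P5a : Prop := forall (a : A) (v : U),
  exists u, adom act a u /\ lact act a u = v.

Definition P5b : Prop := forall (u : U) (b : A),
  exists a, adom act a u /\ ract act a u = b.

(* The equations in P7a - P7d are required only where the action is defined:
   definedness is asserted separately, in P7e and P7f. *)
Definition P7a : Prop := forall (a : A) (u : U),
  right_identity MU u -> adom act a u -> ract act a u = a.

Definition P7b : Prop := forall (a : A) (u : U),
  left_identity MU u -> adom act a u -> ract act a u = a.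

Definition P7c : Prop := forall (a : A) (u : U),
  right_identity MA a -> adom act a u -> lact act a u = u.

Definition P7d : Prop := forall (a : A) (u : U),
  left_identity MA a -> adom act a u -> lact act a u = u.

Definition P7e : Prop := forall u : U, right_identity MU u ->
  forall a : A, adom act a u /\ right_identity MU (lact act a u).

Definition P7f : Prop := forall a : A, left_identity MA a ->
  forall u : U, adom act a u /\ left_identity MA (ract act a u).

Definition P7g : Prop := forall (a : A) (u : U),
  adom act a u -> right_identity MU (lact act a u) -> right_identity MU u.

Definition P7h : Prop := forall (a : A) (u : U),
  adom act a u -> left_identity MA (ract act a u) -> left_identity MA a.

Record embedding_functions
    (E : U -> A -> Prop) (i : A -> U) (j : U -> A) : Prop := {
  embed_j : forall u : U,
    [/\ full_identity MA (j u),
        forall v, pdom MU u v -> j u = j v /\ j v = j (pmul MU u v),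
        E u (j u) &
        [/\ adom act (j u) u, lact act (j u) u = u, ract act (j u) u = j u &
            pdom MA (j u) (j u)]];
  embed_i : forall a : A,
    [/\ full_identity MU (i a),
        forall b, pdom MA a b -> i a = i b /\ i b = i (pmul MA a b),
        E (i a) a &
        [/\ adom act a (i a), lact act a (i a) = i a, ract act a (i a) = a &
            pdom MU (i a) (i a)]];
  embed_H : forall (a : A) (u : U), adom act a u ->
    pdom MU (i a) (lact act a u) /\ pdom MA (ract act a u) (j u);
  embed_E : forall (u : U) (a : A), E u a ->
    [/\ adom act (j u) (i a), lact act (j u) (i a) = i a,
        ract act (j u) (i a) = j u &
        pdom MU u (i a) /\ pdom MA (j u) a]
}.

End ZappaSzep.

(* Main.v *)
(** Since [(w, b)(u, a)] has first component [w(b.u)], a right identity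
    [(u, a)] makes [b.u] a right identity, hence [u] by (P7)(g).  A left inverse
    of [(u, a)] is [(w, c)] with [c^u] a left inverse of [a] and [w] a left
    inverse of [c.u]; in a group [c = (a^-1)^(u^-1)] works by (P2)(d). *)
Require Import Defs.
From mathcomp Require Import ssreflect ssrfun ssrbool.

Set Implicit Arguments.
Unset Strict Implicit.
Unset Printing Implicit Defensive.

Lemma monoid_unit_right_identity (X : Type) (M : partial_mul X) (e : X) :
  monoid_with_unit M e -> right_identity M e.
Proof. by case=> D _ _ e1; split; [move=> x _; split|exists e]. Qed.

Lemma monoid_unit_left_identity (X : Type) (M : partial_mul X) (e : X) :
  monoid_with_unit M e -> left_identity M e.
Proof. by case=> D _ e1 _; split; [move=> x _; split|exists e]. Qed.

Lemma monoid_unit_full_identity (X : Type) (M : partial_mul X) (e : X) :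
  monoid_with_unit M e -> full_identity M e.
Proof.
by move=> He; split;
  [apply: monoid_unit_right_identity|apply: monoid_unit_left_identity].
Qed.

(** In a total multiplication [f] can be tested on [e] itself, so [f = ef = e]. This turns (P7)(e)
    into the equation [a.1 = 1]. *)
Lemma monoid_right_identity_eq (X : Type) (M : partial_mul X) (e f : X) :
  monoid_with_unit M e -> right_identity M f -> f = e.
Proof. by case=> D _ e1 _ [/(_ e (D _ _)) [_ ef] _]; rewrite -(e1 f). Qed.

Lemma monoid_left_identity_eq (X : Type) (M : partial_mul X) (e f : X) :
  monoid_with_unit M e -> left_identity M f -> f = e.
Proof. by case=> D _ _ e1 [/(_ e (D _ _)) [_ fe] _]; rewrite -(e1 f). Qed.

(** If [yx = e] and [zy = e], then [x = (zy)x = z(yx) = z], so [y] is also a right inverse of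
    [x]. *)
Lemma monoid_left_inverses_group (X : Type) (M : partial_mul X) (e : X) :
  monoid_with_unit M e -> (forall x, exists y, pmul M y x = e) -> is_group M.
Proof.
move=> He linv; exists e => // x; have [_ mA mul1 mul_1] := He.
have [y yx] := linv x; have [z zy] := linv y.
have xz : x = z by rewrite -(mul1 x) -zy -mA yx mul_1.
by exists y; split; first rewrite xz.
Qed.

Section ZappaSzepIdentities.
Variables (U A : Type) (MU : partial_mul U) (MA : partial_mul A).
Variable act : mutual_actions A U.

Lemma zs_right_identity_components (u : U) (a : A) :
  P7a MU act -> P7e MU act -> P7g MU act ->
  right_identity (zs_product MU MA act) (u, a) ->
  right_identity MU u /\ right_identity MA a.
Proof.
move=> p7a p7e p7g [uaP [[v b] /= [Hbu Dv Db]]].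
have uR : right_identity MU u.
  apply: (p7g b) => //; split; last by exists v.
  (* Since [b^u a] is already defined, [(w, b)(u, a)] is defined as soon as [w(b.u)] is; its first
     component gives [w(b.u) = w]. *)
  by move=> w Dw; split=> //; have [|_ /= [-> _]] := uaP (w, b).
split=> //; split; last by exists (ract act b u).
(* As a right identity, [c.u] comes with some [w] for which [w(c.u)] is defined. This makes
   [(w, c)(u, a)] defined, and its second component is [ca]. *)
move=> c Dc; have [Hcu [_ [w Dw]]] := p7e u uR c.
have cu : ract act c u = c by apply: p7a.
have [|_ /= [_]] := uaP (w, c); first by split; rewrite //= cu.
by rewrite cu; split.
Qed.

(** Here [b.u] is a right identity and [b^u = b], so [(v, b)(u, a) = (v(b.u), ba) = (v, b)]. *)
Lemma zs_right_identity_pair (u : U) (a : A) :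
  P7a MU act -> P7e MU act ->
  right_identity MU u -> right_identity MA a ->
  right_identity (zs_product MU MA act) (u, a).
Proof.
move=> p7a p7e uR aR; split.
  move=> [v b] D; split=> //; case: D => /= Hbu Dv Db.
  have [_ [/(_ v Dv) [_ ->] _]] := p7e u uR b.
  move: Db; rewrite (p7a b u uR Hbu) => Db.
  by have [/(_ b Db) [_ ->]] := aR.
have [_ [c Dc]] := aR; have [Hcu [_ [w Dw]]] := p7e u uR c.
by exists (w, c); split=> //=; rewrite p7a.
Qed.

Lemma zs_has_right_identities :
  has_right_identities MA -> has_right_identities MU ->
  P7a MU act -> P7e MU act -> P7g MU act -> P5a act ->
  has_right_identities (zs_product MU MA act).
Proof.
move=> rA rU p7a p7e p7g p5a [u a].
have [e [[De ae] eR]] := rA a; have [f [[Df uf] fR]] := rU u.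
(* The first coordinate acts on [u] only through [a], so [f] is pulled back along [a]; (P7)(g) keeps
   the result a right identity. *)
have [w [Haw aw]] := p5a a f.
have wR : right_identity MU w by apply: (p7g a); rewrite ?aw.
have aw' : ract act a w = a by apply: p7a.
exists (w, e); split; last exact: zs_right_identity_pair.
by split; [split|]; rewrite /= ?aw ?aw' ?uf ?ae.
Qed.

Lemma zs_has_left_inverses :
  has_left_inverses_wrt_right_identities MA ->
  has_left_inverses_wrt_right_identities MU ->
  P2a MA act -> P2c MU act ->
  P7a MU act -> P7c MA act -> P7e MU act -> P7g MU act -> P5b act ->
  has_left_inverses_wrt_right_identities (zs_product MU MA act).
Proof.
move=> lA lU p2a p2c p7a p7c p7e p7g p5b [u a] [v b] vbR /= [Hav Du Dab].
have [vR bR] := zs_right_identity_components p7a p7e p7g vbR.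
rewrite (p7a a v vR Hav) in Dab.
have [_ [/(_ u Du) [_ uav] _]] := p7e v vR a.
have [a' [Da' a'a]] := lA a b bR Dab.
have [c [Hcu cu]] := p5b u a'.
have Hbv : adom act b v by have [] := p7e v vR b.
(* By (P2)(a) and (P7)(c), [a'.(a.v) = (a'a).v = b.v = v]. *)
have a'av : lact act a' (lact act a v) = v.
  have [_ /(_ Da')] := p2a a' a v.
  by rewrite a'a => /(_ Hbv) <-; apply: p7c.
(* (c.u)v is defined: c.u = c.(u(a.v)) = (c.u)(c^u.(a.v)) = (c.u)v. *)
have Dcuv : pdom MU (lact act c u) v.
  have [[fwd _] _] := p2c c u (lact act a v).
  have [|_ _] := fwd; first by rewrite uav.
  by rewrite cu a'av.
(* With [w(c.u) = v], the product [(w, c)(u, a)] is [(v, a'a) = (v, b)]. *)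
have [w [Dw wcu]] := lU _ _ vR Dcuv.
by exists (w, c); split; [split|]; rewrite //= cu ?wcu ?a'a.
Qed.

Section Total.
Hypothesis adomT : forall a u, adom act a u.
Variables (oneU : U) (oneA : A).
Hypothesis oneUP : monoid_with_unit MU oneU.
Hypothesis oneAP : monoid_with_unit MA oneA.

Lemma lact_unit (a : A) : P7e MU act -> lact act a oneU = oneU.
Proof.
move=> p7e; apply: (monoid_right_identity_eq oneUP).
by have [] := p7e oneU (monoid_unit_right_identity oneUP) a.
Qed.

Lemma ract_unit (u : U) : P7f MA act -> ract act oneA u = oneA.
Proof.
move=> p7f; apply: (monoid_left_identity_eq oneAP).
by have [] := p7f oneA (monoid_unit_left_identity oneAP) u.
Qed.

Lemma unit_lact (u : U) : P7d MA act -> lact act oneA u = u.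
Proof. by apply=> //; apply: monoid_unit_left_identity. Qed.

Lemma unit_ract (a : A) : P7a MU act -> ract act a oneU = a.
Proof. by apply=> //; apply: monoid_unit_right_identity. Qed.

Lemma zs_monoid_with_unit :
  P2a MA act -> P2b MA act -> P2c MU act -> P2d MU act ->
  P7a MU act -> P7d MA act -> P7e MU act -> P7f MA act ->
  monoid_with_unit (zs_product MU MA act) (oneU, oneA).
Proof.
move=> p2a p2b p2c p2d p7a p7d p7e p7f.
have [DU mUA mul1U mulU1] := oneUP; have [DA mAA mul1A mulA1] := oneAP.
split=> [[u a] [v b] // | [u a] [v b] [w c] | [u a] | [u a]] /=.
(* (P2)(a,b) expand the action of and on [a^v b] in the left-bracketed product, (P2)(c,d) that of
   [a] on [v(b.w)] in the other; associativity in [U] and [A] does the rest. *)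
- have [_ ->] := p2a (ract act a v) b w => //.
  have [_ ->] := p2b (ract act a v) b w => //.
  have [_ ->] := p2c a v (lact act b w) => //.
  have [_ ->] := p2d a v (lact act b w) => //.
  by rewrite mUA mAA.
- by rewrite unit_lact // ract_unit // mul1U mul1A.
- by rewrite lact_unit // unit_ract // mulU1 mulA1.
Qed.

(** For constant maps the conditions reduce to totality and the four laws [1.u = u], [1^u = 1],
    [a.1 = 1], [a^1 = a]. The constantly true relation encodes [E] as all of [U * A]. *)
Lemma unit_embedding_functions :
  P7a MU act -> P7d MA act -> P7e MU act -> P7f MA act ->
  embedding_functions MU MA act (fun _ _ => True)
    (fun _ : A => oneU) (fun _ : U => oneA).
Proof.
move=> p7a p7d p7e p7f; have [DU _ _ _] := oneUP; have [DA _ _ _] := oneAP.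
split=> [u|a|a u _|u a _]; split=> //.
- exact: monoid_unit_full_identity.
- by split; rewrite ?unit_lact ?ract_unit.
- exact: monoid_unit_full_identity.
- by split; rewrite ?lact_unit ?unit_ract.
- exact: lact_unit.
- exact: ract_unit.
Qed.

Lemma zs_group :
  is_group MA -> is_group MU ->
  P2a MA act -> P2b MA act -> P2c MU act -> P2d MU act ->
  P7a MU act -> P7d MA act -> P7e MU act -> P7f MA act ->
  is_group (zs_product MU MA act).
Proof.
move=> [eA eAP invA] [eU eUP invU] p2a p2b p2c p2d p7a p7d p7e p7f.
(* The units hidden in [is_group] are identified with the fixed [oneA] and [oneU]. *)
have eA1 := monoid_right_identity_eq oneAP (monoid_unit_right_identity eAP).
have eU1 := monoid_right_identity_eq oneUP (monoid_unit_right_identity eUP).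
apply: (@monoid_left_inverses_group _ _ (oneU, oneA)).
  exact: zs_monoid_with_unit.
move=> [u a]; have [a' [_ a'a]] := invA a; have [u' [_ u'u]] := invU u.
have [DU _ _ _] := oneUP.
(* An explicit solution of [c^u = a'], in place of the one from (P5)(b):
   [(a'^u')^u = a'^(u'u) = a'^1 = a']. *)
have cu : ract act (ract act a' u') u = a'.
  have [_ /(_ (DU _ _) (adomT _ _)) <-] := p2d a' u' u.
  by rewrite u'u eU1 unit_ract.
have [w [_ wcu]] := invU (lact act (ract act a' u') u).
by exists (w, ract act a' u'); rewrite /= cu wcu a'a eU1 eA1.
Qed.

End Total.
End ZappaSzepIdentities.

Theorem lemma3p13 (U A : Type) (MU : partial_mul U) (MA : partial_mul A)
    (act : mutual_actions A U) :
  (* (xi) *)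
  (P7a MU act -> P7e MU act -> P7g MU act ->
     forall (u : U) (a : A),
       right_identity (zs_product MU MA act) (u, a) ->
       right_identity MU u /\ right_identity MA a) /\
  (* (xii) *)
  (P7a MU act -> P7e MU act ->
     forall (u : U) (a : A),
       right_identity MU u -> right_identity MA a ->
       right_identity (zs_product MU MA act) (u, a)) /\
  (* (xiii) *)
  (has_right_identities MA -> has_right_identities MU ->
     P7a MU act -> P7e MU act -> P7g MU act -> P5a act ->
     has_right_identities (zs_product MU MA act)) /\
  (* (xiv) *)
  (has_left_inverses_wrt_right_identities MA ->
     has_left_inverses_wrt_right_identities MU ->
     P2a MA act -> P2c MU act ->
     P7a MU act -> P7c MA act -> P7e MU act -> P7g MU act -> P5b act ->
     has_left_inverses_wrt_right_identities (zs_product MU MA act)) /\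
  (* (xv) *)
  (is_monoid MA -> is_monoid MU -> (forall a u, adom act a u) ->
     P2a MA act -> P2b MA act -> P2c MU act -> P2d MU act ->
     P7a MU act -> P7d MA act -> P7e MU act -> P7f MA act ->
     is_monoid (zs_product MU MA act) /\
     (forall (oneU : U) (oneA : A),
        monoid_with_unit MU oneU -> monoid_with_unit MA oneA ->
        embedding_functions MU MA act (fun _ _ => True)
          (fun _ : A => oneU) (fun _ : U => oneA))) /\
  (* (xvi) *)
  (is_group MA -> is_group MU -> (forall a u, adom act a u) ->
     P2a MA act -> P2b MA act -> P2c MU act -> P2d MU act ->
     P7a MU act -> P7b MU act -> P7c MA act -> P7d MA act ->
     P7e MU act -> P7f MA act -> P7g MU act -> P7h MA act ->
     is_group (zs_product MU MA act)).
Proof.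
split; first by move=> p7a p7e p7g u a; apply: zs_right_identity_components.
split; first by move=> p7a p7e u a; apply: zs_right_identity_pair.
split; first exact: zs_has_right_identities.
split; first exact: zs_has_left_inverses.
split.
  move=> [eA eAP] [eU eUP] HT p2a p2b p2c p2d p7a p7d p7e p7f; split.
    by exists (eU, eA); apply: zs_monoid_with_unit.
  by move=> oneU oneA oneUP oneAP; apply: unit_embedding_functions.
move=> gA gU HT p2a p2b p2c p2d p7a _ _ p7d p7e p7f _ _.
have [eA eAP _] := gA; have [eU eUP _] := gU.
exact: (zs_group HT eUP eAP).
Qed.
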